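(* Let $n\ge 1$, let $\mathcal{B}$ be a parameter set, and for each $\beta\in\mathcal{B}$ let $h_\beta:[0,\infty)\to[0,\infty)$ be a locally integrable function such that $t\mapsto\int_0^t h_\beta(s)\,ds$ is strictly increasing on $[0,\infty)$. Consider the family of time-dependent sub-intensity matrices of the form $\boldsymbol{\Lambda}(t)=h_\beta(t)\boldsymbol{\Lambda}$, $t\ge 0$, where $\beta\in\mathcal{B}$ and $\boldsymbol{\Lambda}$ is a non-zero $n\times n$ sub-intensity matrix. Then the parametrization $(\boldsymbol{\Lambda},\beta)$ is identifiable at the sub-intensity matrix level if and only if the following condition holds: whenever $\beta_1,\beta_2\in\mathcal{B}$ satisfy $$h_{\beta_1}(t)=c\,h_{\beta_2}(t)\qquad\text{for all } t\ge 0$$ for some constant $c>0$, it follows that $\beta_1=\beta_2$.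
   Context: An $n\times n$ sub-intensity matrix is a real $n\times n$ matrix with non-negative off-diagonal entries and non-positive row sums (hence non-positive diagonal entries). The parametrization $(\boldsymbol{\Lambda},\beta)$ is called identifiable at the sub-intensity matrix level if, for all pairs $(\boldsymbol{\Lambda}_1,\beta_1)$ and $(\boldsymbol{\Lambda}_2,\beta_2)$ with $\boldsymbol{\Lambda}_1,\boldsymbol{\Lambda}_2$ non-zero $n\times n$ sub-intensity matrices and $\beta_1,\beta_2\in\mathcal{B}$, the equality $h_{\beta_1}(t)\boldsymbol{\Lambda}_1=h_{\beta_2}(t)\boldsymbol{\Lambda}_2$ for all $t\ge 0$ implies $\boldsymbol{\Lambda}_1=\boldsymbol{\Lambda}_2$ and $\beta_1=\beta_2$. *)

(* Defs.v *)
From mathcomp Require Import all_boot all_order all_algebra.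
From mathcomp Require Import all_classical all_reals all_analysis.
Import Order.TTheory GRing.Theory Num.Theory.
Import numFieldNormedType.Exports.

Set Implicit Arguments.
Unset Strict Implicit.
Unset Printing Implicit Defensive.

Local Open Scope classical_set_scope.
Local Open Scope ring_scope.

(* Functions on [0, oo) are represented by total functions on R, whose values
   at negative arguments are never constrained or used. *)

Definition sub_intensity (R : realType) (n : nat) (L : 'M[R]_n) : Prop :=
  (forall i j : 'I_n, i != j -> 0 <= L i j) /\
  (forall i : 'I_n, \sum_(j < n) L i j <= 0).

(* The library's [locally_integrable] requires an open domain, which [0, oo)
   is not. The completed Lebesgue measure is used so that Lebesgue-measurable
   functions that are not Borel are covered as well; measurability of f on D
   is part of integrability on the compact subsets when D = [0, oo). *)
Definition locally_integrable_on (R : realType) (D : set R) (f : R -> R)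
    : Prop :=
  forall K : set R, K `<=` D -> compact K ->
    (@completed_lebesgue_measure R).-integrable K (EFin \o f).

Definition cumulative_integral (R : realType) (f : R -> R) (t : R) : R :=
  \int[@completed_lebesgue_measure R]_(s in `[0, t]) f s.

Definition identifiable (R : realType) (n : nat) (B : Type) (h : B -> R -> R)
    : Prop :=
  forall (L1 L2 : 'M[R]_n) (b1 b2 : B),
    sub_intensity L1 -> L1 != 0 ->
    sub_intensity L2 -> L2 != 0 ->
    (forall t : R, 0 <= t -> h b1 t *: L1 = h b2 t *: L2) ->
    L1 = L2 /\ b1 = b2.

(* Main.v *)
Require Import Defs.
From mathcomp Require Import all_boot all_order all_algebra.
From mathcomp Require Import all_classical all_reals all_analysis.
Import Order.TTheory GRing.Theory Num.Theory.
Import numFieldNormedType.Exports.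

(** If [h b1 *: L1 = h b2 *: L2], evaluating at a point [t] with [h b1 t > 0]
    gives [L2 = c *: L1] for [c = h b1 t / h b2 t > 0]; as [L1 != 0] this forces
    [h b1 = c * h b2] everywhere, so the condition gives [b1 = b2], and then
    [c = 1]. Conversely, if [h b1 = c * h b2], the pairs [(- 1, b1)] and
    [(- c, b2)] of scalar matrices and parameters give the same family. *)

Local Open Scope classical_set_scope.
Local Open Scope ring_scope.

Lemma sub_intensity_scalar (R : realType) (n : nat) (a : R) :
  a <= 0 -> sub_intensity (a%:M : 'M[R]_n).
Proof.
move=> a_le0; split=> [i j /negPf ij|i]; first by rewrite mxE ij.
by apply: sumr_le0 => j _; rewrite mxE; case: (i == j).
Qed.

Lemma scalar_mx_neq0 (R : realType) (n : nat) (a : R) :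
  (0 < n)%N -> a != 0 -> (a%:M : 'M[R]_n) != 0.
Proof.
case: n => // n _; apply: contraNneq => /matrixP /(_ ord0 ord0).
by rewrite !mxE eqxx => /eqP.
Qed.

Lemma cumulative_integral_eq0 (R : realType) (f : R -> R) (t : R) :
  (forall s, 0 <= s -> f s = 0) -> cumulative_integral f t = 0.
Proof.
move=> f0; rewrite /cumulative_integral /Rintegral integral0_eq// => s /=.
by rewrite in_itv/= => /andP[/f0 ->].
Qed.

(** Otherwise [f], being non-negative, would vanish on the whole half-line, and both cumulative
    integrals would be 0, against the strict inequality. *)
Lemma exists_gt0 (R : realType) (f : R -> R) :
  (forall t, 0 <= t -> 0 <= f t) ->
  cumulative_integral f 0 < cumulative_integral f 1 ->
  exists2 t, 0 <= t & 0 < f t.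
Proof.
move=> f_ge0 lt01; apply: contrapT => nf.
have f0 s : 0 <= s -> f s = 0.
  move=> s0; apply/eqP/negP => fs; apply: nf; exists s => //.
  by rewrite lt_def f_ge0// andbT; apply/negP.
by move: lt01; rewrite !cumulative_integral_eq0// ltxx.
Qed.

Theorem proposition2 (R : realType) (n : nat) (hn : (1 <= n)%N)
    (B : Type) (h : B -> R -> R)
    (h_ge0 : forall (b : B) (t : R), 0 <= t -> 0 <= h b t)
    (h_int : forall b : B, locally_integrable_on [set t : R | 0 <= t] (h b))
    (h_incr : forall (b : B) (s t : R), 0 <= s -> s < t ->
       cumulative_integral (h b) s < cumulative_integral (h b) t) :
  identifiable n h <->
  (forall b1 b2 : B,
     (exists2 c : R, 0 < c & forall t : R, 0 <= t -> h b1 t = c * h b2 t) ->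
     b1 = b2).
Proof.
split=> [idh b1 b2 [c c_gt0 hc]|cond L1 L2 b1 b2 _ L1_neq0 _ _ hL].
  have [] // := idh (-1)%:M (- c)%:M b1 b2.
  - by apply: sub_intensity_scalar; rewrite oppr_le0 ler01.
  - by apply: scalar_mx_neq0; rewrite // oppr_eq0 oner_eq0.
  - by apply: sub_intensity_scalar; rewrite oppr_le0 ltW.
  - by apply: scalar_mx_neq0; rewrite // oppr_eq0 gt_eqF.
  - by move=> t t_ge0; rewrite !scale_scalar_mx hc// mulrN1 mulrN mulrC.
have [t t_ge0 h1_gt0] := exists_gt0 _ _ (h_ge0 b1) (h_incr b1 _ _ (lexx 0) ltr01).
have h2_neq0 : h b2 t != 0.
  (* If [h b2 t] were 0, [hL] would give [h b1 t *: L1 = 0] with [h b1 t > 0], hence [L1 = 0]. *)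
  apply: contraNneq L1_neq0 => h2_eq0; move/eqP: (hL t t_ge0).
  by rewrite h2_eq0 scale0r scaler_eq0 gt_eqF.
have h2_gt0 : 0 < h b2 t by rewrite lt_def h2_neq0 h_ge0.
pose c := h b1 t / h b2 t.
have L2E : L2 = c *: L1.
  by rewrite /c mulrC -scalerA hL// scalerA mulVf// scale1r.
have b12 : b1 = b2.
  apply: cond; exists c => [|s s_ge0]; first exact: divr_gt0.
  (* Substituting [L2 = c *: L1] turns [hL] at [s] into [(h b1 s - h b2 s * c) *: L1 = 0], where the
     non-zero [L1] forces the scalar to vanish. *)
  apply/eqP; rewrite -subr_eq0; move/eqP: (hL s s_ge0).
  rewrite L2E scalerA -subr_eq0 -scalerBl scaler_eq0 (negPf L1_neq0) orbF.
  by rewrite [c * _]mulrC.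
(* Once [b1 = b2], the numerator and denominator of [c] coincide. *)
by split=> //; rewrite L2E /c b12 divff// scale1r.
Qed.
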